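(* Let $q>2$. Suppose that $c \in \mathcal{C}_{n-1}(n,q)$ and $0 < \mathrm{wt}(c) \leq 2q^{n-1}$. Then either - $\mathrm{wt}(c) = \theta_{n-1}$ and $c = \alpha \chi_\pi$, or - $\mathrm{wt}(c) = 2q^{n-1}$ and $c = \alpha(\chi_\pi - \chi_\rho)$, with $\alpha \in \mathbb{F}_p$, and $\pi$, $\rho$ hyperplanes of $\mathrm{PG}(n,q)$.
   Context: Here $p$ is a prime number and $q=p^h$ for some positive integer $h$. $\mathrm{PG}(n,q)$ is the $n$-dimensional projective space over the finite field $\mathbb{F}_q$, with point set $\mathcal{P}$. For a set $B$ of points, $\chi_B:\mathcal{P}\to\mathbb{F}_p$ is its characteristic function (value $1$ on $B$ and $0$ elsewhere). $\mathcal{C}_{n-1}(n,q)$ is the $\mathbb{F}_p$-subspace of the space $\mathbb{F}_p^{\mathcal{P}}$ of functions $\mathcal{P}\to\mathbb{F}_p$ spanned by the characteristic functions of the hyperplanes (the $(n-1)$-dimensional subspaces) of $\mathrm{PG}(n,q)$. For $c \in \mathbb{F}_p^{\mathcal{P}}$, $\mathrm{wt}(c)$ is the number of points $P$ with $c(P)\neq 0$. $\theta_{n-1} = \frac{q^n-1}{q-1}$ is the number of points of $\mathrm{PG}(n-1,q)$.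
   Formalization: The formal theorem assumes n ≥ 2. For n = 1 hyperplanes are points and the code is the whole space, so for odd q the function χ_P + χ_Q with P ≠ Q has weight 2 and is of neither form; the trivial case n = 1 with q even is also left out. *)

(* Defs.v *)
From HB Require Import structures.
From mathcomp Require Import all_boot all_algebra.

Set Implicit Arguments.
Unset Strict Implicit.
Unset Printing Implicit Defensive.

Import GRing.Theory.
Local Open Scope ring_scope.

(* Over a finite field there are finitely many subspaces; the vector library
   only provides the choiceType structure on {vspace vT}. *)
Section FiniteSubspaces.
Import VectorInternalTheory.
Variables (F : finFieldType) (vT : vectType F).
HB.instance Definition _ := [Countable of {vspace vT} by <:].
HB.instance Definition _ := [Finite of {vspace vT} by <:].
End FiniteSubspaces.

(* k-dimensional subspaces of PG(n, #|F|), i.e. (k+1)-dimensional vector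
   subspaces of F^(n+1). *)
Definition pg_subspace (F : finFieldType) (n k : nat) :=
  {U : {vspace 'rV[F]_n.+1} | \dim U == k.+1}.

Definition pg_point (F : finFieldType) (n : nat) := pg_subspace F n 0.

(* Meaningful for n > 0 only, because n.-1 is truncated. *)
Definition pg_hyperplane (F : finFieldType) (n : nat) := pg_subspace F n n.-1.

Definition pg_points (F : finFieldType) (n k : nat) (U : pg_subspace F n k)
  : {set pg_point F n} := [set P | (val P <= val U)%VS].

(* F_p^P; the regular module ('F_p)^o makes it a vector space over 'F_p. *)
Notation pg_fun p F n := {ffun pg_point F n -> ('F_p)^o}.

Definition pg_chi (p : nat) (F : finFieldType) (n : nat)
  (B : {set pg_point F n}) : pg_fun p F n := [ffun P => (P \in B)%:R].

Definition pg_wt (p : nat) (F : finFieldType) (n : nat) (c : pg_fun p F n)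
  : nat := #|[set P | c P != 0]|.

Definition pg_hyperplane_code (p : nat) (F : finFieldType) (n : nat)
  : {vspace pg_fun p F n} :=
  <<[seq pg_chi p (pg_points H) | H : pg_hyperplane F n]>>%VS.

(* Main.v *)
Require Import Defs.
From mathcomp Require Import all_boot all_algebra all_field.
From mathcomp Require Import zify ring.

(* A codeword c of the hyperplane code becomes a function C on F^(n+1) that is a
   constant s minus a form of degree q - 1, since a hyperplane x.a = 0 has
   characteristic function 1 - (x.a)^(q-1).  By averaging, some hyperplane H
   meets the support of c in few points, so by induction on n the restriction of
   c to H is s times the characteristic function of a hyperplane of H (or 0).
   On the affine space complementary to H this makes C a polynomial function of
   degree q - 1 whose leading form is - s x^(q-1) for one coordinate x, plus
   terms of degree at most q - 2.  If C vanishes on exactly k of the q slices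
   x = t, dividing by the product of the k factors x - t and applying the
   Schwartz-Zippel bound shows that each other slice contains at least
   (k + 2) q^(n-2) points of the support, and (q - k)(k + 2) >= 2q unless
   k = q - 1.  So for s <> 0 the affine support lies in one slice.
   For s = 0, averaging over the hyperplanes through a point outside H and the
   support gives a second hyperplane on which C vanishes, hence k >= 1; then
   (q - k)(k + 2) <= 2q forces k = q - 2, and both remaining slices are
   constant. *)

Set Implicit Arguments.
Unset Strict Implicit.
Unset Printing Implicit Defensive.

Import GRing.Theory.
Local Open Scope ring_scope.

Local Notation row_cons x y := (row_mx (x%:M : 'M_1) y).

(** * Polynomial functions of bounded total degree *)

Section PolynomialFunctions.
Variable F : fieldType.

(** Total degree is encoded by recursion on the first coordinate. Only the existence of a
    representation of degree at most [d] is asked; no normal form modulo x^q - x is chosen. *)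
Fixpoint polyfn (m d : nat) : ('rV[F]_m -> F) -> Prop :=
  match m return ('rV[F]_m -> F) -> Prop with
  | 0 => fun _ => True
  | m'.+1 => fun f => exists2 g : nat -> 'rV[F]_m' -> F,
      forall i, polyfn (d - i) (g i)
      & forall x y, f (row_cons x y) = \sum_(i < d.+1) x ^+ i * g i y
  end.

Lemma rV_split m (P : 'rV[F]_(1 + m) -> Prop) :
  (forall x y, P (row_cons x y)) -> forall v, P v.
Proof. by move=> H v; rewrite -[v]hsubmxK [lsubmx v]mx11_scalar; apply: H. Qed.

Lemma mul_row_scalar m x (y : 'rV[F]_m) (a : 'cV[F]_(1 + m)) :
  (row_cons x y *m a) 0 0
  = x * usubmx a 0 0 + (y *m dsubmx a) 0 0.
Proof. by rewrite -{1}[a]vsubmxK mul_row_col mul_scalar_mx [LHS]mxE mxE. Qed.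

Lemma polyfn_ext m d (f1 f2 : 'rV[F]_m -> F) :
  f1 =1 f2 -> polyfn d f1 -> polyfn d f2.
Proof.
case: m f1 f2 => [//|m] f1 f2 E [g Hg Hf]; exists g => // x y.
by rewrite -E Hf.
Qed.

Lemma polyfn0 m d : @polyfn m d (fun _ => 0).
Proof.
elim: m d => [//|m IH] d; exists (fun _ _ => 0) => [i|x y]; first exact: IH.
by rewrite big1 // => i _; rewrite mulr0.
Qed.

Lemma polyfn_leq m d1 d2 (f : 'rV[F]_m -> F) :
  (d1 <= d2)%N -> polyfn d1 f -> polyfn d2 f.
Proof.
elim: m d1 d2 f => [//|m IH] d1 d2 f le [g Hg Hf].
exists (fun i => if (i <= d1)%N then g i else fun _ => 0) => [i|x y].
  by case: ifP => _; [apply: IH (Hg i); rewrite leq_sub2r | apply: polyfn0].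
rewrite Hf -(big_mkord xpredT (fun i => x ^+ i * g i y)).
rewrite -(big_mkord xpredT (fun i => x ^+ i * (if (i <= d1)%N then g i else _) y)).
rewrite (big_cat_nat (n := d1.+1) (p := d2.+1)) //=.
rewrite [X in _ = _ + X]big_nat [X in _ = _ + X]big1 ?addr0.
  by apply: eq_big_nat => i /andP[_]; rewrite ltnS => ->.
by move=> i /andP[lt _]; rewrite leqNgt lt /= mulr0.
Qed.

Lemma polyfn_const m d a : @polyfn m d (fun _ => a).
Proof.
elim: m d => [//|m IH] d; exists (fun i _ => if i == 0%N then a else 0) => [i|x y].
  by case: (i == 0%N); [apply: IH | apply: polyfn0].
rewrite big_ord_recl /= mul1r big1 ?addr0 // => i _; by rewrite mulr0.
Qed.

Lemma polyfnD m d (f1 f2 : 'rV[F]_m -> F) :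
  polyfn d f1 -> polyfn d f2 -> polyfn d (fun y => f1 y + f2 y).
Proof.
elim: m d f1 f2 => [//|m IH] d f1 f2 [g1 G1 E1] [g2 G2 E2].
exists (fun i y => g1 i y + g2 i y) => [i|x y].
  exact: IH (G1 i) (G2 i).
by rewrite E1 E2 -big_split; apply: eq_bigr => i _ /=; rewrite mulrDr.
Qed.

Lemma polyfnZ m d a (f : 'rV[F]_m -> F) :
  polyfn d f -> polyfn d (fun y => a * f y).
Proof.
elim: m d f => [//|m IH] d f [g G E].
exists (fun i y => a * g i y) => [i|x y]; first exact: IH (G i).
by rewrite E mulr_sumr; apply: eq_bigr => i _ /=; rewrite mulrCA.
Qed.

Lemma polyfn_sum m d (I : Type) (r : seq I) (P : pred I) (f : I -> 'rV[F]_m -> F) :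
  (forall i, P i -> polyfn d (f i)) -> polyfn d (fun y => \sum_(i <- r | P i) f i y).
Proof.
move=> H; elim: r => [|i r IH].
  by apply: polyfn_ext (polyfn0 _ _) => y; rewrite big_nil.
case Pi: (P i); last by apply: polyfn_ext IH => y; rewrite big_cons Pi.
by apply: polyfn_ext (polyfnD (H i Pi) IH) => y; rewrite big_cons Pi.
Qed.

Lemma polyfnM_affine m d b (a : 'cV[F]_m) (f : 'rV[F]_m -> F) :
  polyfn d f -> polyfn d.+1 (fun y => (b + (y *m a) 0 0) * f y).
Proof.
elim: m d b a f => [//|m IH] d b a f [g G E].
set a0 := usubmx (a : 'cV_(1 + m)) 0 0; set a' := dsubmx (a : 'cV_(1 + m)).
(* The guard matters for [i > d]: there [d.+1 - i] is 0, but an affine form times [g i] need not be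
   constant. *)
exists (fun i y => (if (i <= d)%N then (b + (y *m a') 0 0) * g i y else 0) +
                   (if i is j.+1 then a0 * g j y else 0)) => [i|x y].
  apply: polyfnD; last case: i => [|i].
  - case: leqP => le; last exact: polyfn0.
    by rewrite subSn //; apply: IH (G i).
  - exact: polyfn0.
  - by rewrite subSS; apply/polyfnZ/G.
rewrite E mul_row_scalar -/a0 -/a'; set w := (y *m a') 0 0.
under [RHS]eq_bigr do rewrite mulrDr.
rewrite big_split /= [X in _ = X + _]big_ord_recr /= ltnn mulr0 addr0.
rewrite [X in _ = _ + X]big_ord_recl /= mulr0 add0r.
rewrite !mulr_sumr -big_split; apply: eq_bigr => i _ /=.
by rewrite -ltnS ltn_ord exprS; clear; ring.
Qed.

Lemma polyfn_affineX m b (a : 'cV[F]_m) k d (f : 'rV[F]_m -> F) :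
  polyfn d f -> polyfn (k + d) (fun y => (b + (y *m a) 0 0) ^+ k * f y).
Proof.
move=> Hf; elim: k => [|k IH].
  by apply: polyfn_ext Hf => y; rewrite mul1r.
by apply: polyfn_ext (polyfnM_affine b a IH) => y; rewrite exprS mulrA.
Qed.

(* The leading forms cancel. *)
Lemma polyfn_affineX_diff m b (a : 'cV[F]_m) k :
  polyfn k (fun y => (b + (y *m a) 0 0) ^+ k.+1 - (y *m a) 0 0 ^+ k.+1).
Proof.
have P (i : 'I_k.+1) :
    polyfn k (fun y => (b + (y *m a) 0 0) ^+ (k - i) * (y *m a) 0 0 ^+ i).
  have le : (k - i + (i + 0) <= k)%N by have := ltn_ord i; lia.
  apply: polyfn_leq le _; apply: polyfn_affineX.
  have := polyfn_affineX 0 a i (polyfn_const m 0 1).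
  by apply: polyfn_ext => y; rewrite mulr1 add0r.
(* The factor [b] is the difference of the two bases in the factorization of a difference of
   powers. *)
have := polyfnZ b (polyfn_sum (index_enum 'I_k.+1) (P := xpredT) (fun i _ => P i)).
apply: polyfn_ext => y; move: ((y *m a) 0 0) => w.
by rewrite subrXX addrK.
Qed.

Lemma polyfn0_const m (f : 'rV[F]_m -> F) y1 y2 : polyfn 0 f -> f y1 = f y2.
Proof.
elim: m f y1 y2 => [|m IH] f y1 y2; first by rewrite (thinmx0 y1) (thinmx0 y2).
case=> g G E; move: y1 y2; apply: rV_split => x1 y1; apply: rV_split => x2 y2.
by rewrite !E !big_ord1 !mul1r; congr (_); apply: IH (G 0).
Qed.

(* Division of f by x - t, for each t in Z: both D and e drop by one.  Besides
   degree D = e this covers D = e.+1, where by the truncation of e - i the term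
   x^D still has a constant coefficient. *)
Lemma polyfn_slices m (D e : nat) (f : F -> 'rV[F]_m -> F)
    (g : nat -> 'rV[F]_m -> F) (Z : seq F) :
  (forall i, polyfn (e - i) (g i)) ->
  (forall x y, f x y = \sum_(i < D.+1) x ^+ i * g i y) ->
  uniq Z -> (forall t y, t \in Z -> f t y = 0) ->
  (exists x y, f x y != 0) ->
  (size Z <= D)%N /\ forall x, x \notin Z -> polyfn (e - size Z) (f x).
Proof.
elim: Z D e f g => [|t Z IH] D e f g Hg Ef.
  move=> _ _ _; split=> // x _; rewrite subn0.
  apply: (@polyfn_ext _ _ (fun y => \sum_(i < D.+1) x ^+ i * g i y)).
    by move=> y; rewrite Ef.
  by apply: polyfn_sum => i _; apply/polyfnZ/polyfn_leq/Hg/leq_subr.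
move=> /= /andP[tZ uZ] fZ [x0 [y0 f0]].
have ft y : f t y = 0 by apply: fZ; rewrite inE eqxx.
(* For [D = 0] the function does not depend on [x], so one zero slice would make it vanish
   identically. *)
case: D => [|D] in Ef *.
  have E0 : f x0 y0 = f t y0 by rewrite !Ef !big_ord1.
  by rewrite E0 ft eqxx in f0.
(* The coefficient of [x ^+ j] in the quotient of [f x y - f t y] by [x - t]. *)
pose g' j y := \sum_(i < D.+2 | (j < i)%N) t ^+ (i.-1 - j) * g i y.
pose f' x y := \sum_(j < D.+1) x ^+ j * g' j y.
have Ef' x y : f x y = (x - t) * f' x y.
  rewrite -[LHS]subr0 -[X in _ - X](ft y) !Ef -sumrB.
  transitivity (\sum_(i < D.+2)
      (x - t) * (\sum_(j < i) x ^+ (i.-1 - j) * t ^+ j) * g i y).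
    by apply: eq_bigr => i _; rewrite -mulrBl subrXX.
  under eq_bigr do rewrite -mulrA.
  rewrite -mulr_sumr; congr (_ * _); rewrite /f' /g'.
  under [RHS]eq_bigr do rewrite mulr_sumr.
  rewrite (exchange_big_dep xpredT) //=; apply: eq_bigr => i _.
  rewrite (reindex_inj rev_ord_inj) /= mulr_suml.
  rewrite (big_ord_widen_cond D.+1 xpredT
    (fun j => x ^+ (i.-1 - (i - j.+1)) * t ^+ (i - j.+1) * g i y)).
    apply: eq_bigr => j lt; rewrite mulrA; congr (_ * t ^+ _ * _); last by lia.
    by congr (_ ^+ _); lia.
  by rewrite -ltnS.
(* [g' j] involves only [g i] with [i > j], of degree at most [e - i <= e.-1 - j]. *)
have [] := IH D e.-1 f' g' _ _ uZ.
- move=> j; apply: polyfn_sum => i lt; apply/polyfnZ/polyfn_leq/Hg; lia.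
- by [].
- move=> u y uZ'; have := fZ u y; rewrite inE uZ' orbT Ef' => /(_ isT)/eqP.
  rewrite mulf_eq0 subr_eq0 => /orP[/eqP ut|/eqP //].
  by rewrite -ut uZ' in tZ.
- by exists x0, y0; apply: contraNneq f0; rewrite Ef' => ->; rewrite mulr0.
move=> le H; split=> // x; rewrite inE negb_or => /andP[_ xZ].
apply: polyfn_ext (polyfnZ (x - t) (polyfn_leq _ (H x xZ))) => [y|]; last by lia.
by rewrite Ef'.
Qed.

End PolynomialFunctions.

(** * Zero slices, the Schwartz-Zippel bound and power sums *)

Section SchwartzZippel.
Variable F : finFieldType.
Local Notation q := #|F|.

Lemma card_rV_slices m (P : pred 'rV[F]_(1 + m)) :
  #|[set v | P v]| = \sum_x #|[set y | P (row_cons x y)]|.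
Proof.
rewrite -sum1_card.
under [RHS]eq_bigr do rewrite -sum1_card.
rewrite pair_big_dep /= (reindex (fun p : F * 'rV[F]_m => row_cons p.1 p.2)).
  by apply: eq_bigl => -[x y]; rewrite !inE.
apply: onW_bij; exists (fun v => (lsubmx v 0 0, rsubmx v)) => [[x y]|v] /=.
  by rewrite row_mxKl row_mxKr mxE.
by rewrite -mx11_scalar hsubmxK.
Qed.

Definition zero_slices m (f : F -> 'rV[F]_m -> F) : {set F} :=
  [set x | [forall y, f x y == 0]].

Lemma sum_slices_ge m (f : F -> 'rV[F]_m -> F) b :
  (forall x, x \notin zero_slices f -> (b <= q * #|[set y | f x y != 0%R]|)%N) ->
  ((q - #|zero_slices f|) * b <= q * \sum_x #|[set y | f x y != 0%R]|)%N.
Proof.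
move=> H; have -> : (q - #|zero_slices f| = #|~: zero_slices f|)%N.
  by rewrite [RHS]cardsCs setCK.
rewrite -sum_nat_const big_distrr big_mkcond /=; apply: leq_sum => x _; rewrite in_setC.
by case: ifP => // /H.
Qed.

Lemma polyfn_zero_slices m (D e : nat) (f : F -> 'rV[F]_m -> F)
    (g : nat -> 'rV[F]_m -> F) :
  (forall i, polyfn (e - i) (g i)) ->
  (forall x y, f x y = \sum_(i < D.+1) x ^+ i * g i y) ->
  (exists x y, f x y != 0) ->
  (#|zero_slices f| <= D)%N /\
  forall x, x \notin zero_slices f -> polyfn (e - #|zero_slices f|) (f x).
Proof.
move=> Hg Ef fn0.
have := @polyfn_slices F m D e f g (enum (zero_slices f)) Hg Ef (enum_uniq _) _ fn0.
rewrite -cardE; case=> [t y|le H].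
  by rewrite mem_enum inE => /forallP/(_ y)/eqP.
by split=> // x xZ; apply: H; rewrite mem_enum.
Qed.

(* q * |supp f| >= (q - d) q^m also covers m = 0, without division. *)
Lemma schwartz_zippel m d (f : 'rV[F]_m -> F) :
  polyfn d f -> (exists y, f y != 0) ->
  ((q - d) * q ^ m <= q * #|[set y | f y != 0%R]|)%N.
Proof.
elim: m d f => [|m IH] d f.
  move=> _ [y fy]; rewrite expn0 muln1.
  have : (0 < #|[set y | f y != 0%R]|)%N by apply/card_gt0P; exists y; rewrite inE.
  by nia.
case=> g Hg Ef [y0 fy0]; pose f' x y := f (row_cons x y).
have fn0 : exists x y, f' x y != 0.
  by move: y0 fy0; apply: rV_split => x y H; exists x, y.
have [le H] := polyfn_zero_slices Hg Ef fn0.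
rewrite (card_rV_slices (fun v => f v != 0)).
have K := @sum_slices_ge m f' ((q - (d - #|zero_slices f'|)) * q ^ m)%N.
apply: (leq_trans _ (K _)) => [|x xZ].
  (* With k zero slices this is (q - d) q <= (q - k)(q - (d - k)); for d <= q the difference is k (d
     - k), and k <= d. *)
  rewrite expnS !mulnA leq_mul2r; apply/orP; right.
  by move: le; rewrite -/f'; move: #|zero_slices f'| => k le; nia.
apply: IH (H x xZ) _.
by move: xZ; rewrite inE negb_forall => /existsP[y]; exists y.
Qed.

(** Division by the zero slices, followed by Schwartz-Zippel on each remaining slice. [D] and [e]
    are separate because both [D = e] and [D = e.+1] occur below, with [e = q.-2]. *)
Lemma polyfn_slices_card m (D e : nat) (f : F -> 'rV[F]_m -> F)
    (g : nat -> 'rV[F]_m -> F) (k := #|zero_slices f|) :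
  (forall i, polyfn (e - i) (g i)) ->
  (forall x y, f x y = \sum_(i < D.+1) x ^+ i * g i y) ->
  (exists x y, f x y != 0) ->
  [/\ (k <= D)%N, forall x, x \notin zero_slices f -> polyfn (e - k) (f x)
    & ((q - k) * ((q - (e - k)) * q ^ m)
        <= q * \sum_x #|[set y | f x y != 0%R]|)%N].
Proof.
move=> Hg Ef fn0; have [le H] := polyfn_zero_slices Hg Ef fn0; split=> //.
apply: sum_slices_ge => x xZ; apply: schwartz_zippel (H x xZ) _.
by move: xZ; rewrite inE negb_forall => /existsP[y]; exists y.
Qed.

(** Substituting g x for x multiplies the sum by g^i. A nonzero g with g^i different from 1 exists,
    as X^i - 1 has at most i < q - 1 roots. For i = 0, translating the sum of all x by 1 shows that
    q ones add up to 0. *)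
Lemma sum_expf_lt i : (i < q.-1)%N -> \sum_(x : F) x ^+ i = 0.
Proof.
case: i => [_|i lt].
  under eq_bigr do rewrite expr0.
  have inj : injective (fun x : F => x + 1) by apply: addIr.
  have : \sum_(x : F) x = \sum_(x : F) (x + 1) by rewrite [LHS](reindex_inj inj).
  by rewrite big_split /= -[LHS]addr0 => /addrI <-.
have [g gn0 gi] : exists2 g : F, g != 0 & g ^+ i.+1 != 1.
  apply/exists_inP; rewrite -negb_forall_in; apply/negP => /forall_inP H.
  have /max_poly_roots : 'X^(i.+1) - 1%:P != 0 :> {poly F}.
    by rewrite -size_poly_eq0 size_XnsubC.
  move=> /(_ (enum [set~ 0])); rewrite size_XnsubC // enum_uniq -cardE cardsC1.
  have -> : all (root ('X^(i.+1) - 1%:P)) (enum [set~ (0 : F)]).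
    apply/allP => x; rewrite mem_enum !inE => /H/eqP xi.
    by rewrite /root !hornerE xi subrr.
  by move=> /(_ isT isT); rewrite ltnS leqNgt lt.
have inj : injective ( *%R g) by apply: mulfI.
have: (1 - g ^+ i.+1) * \sum_x x ^+ i.+1 = 0.
  rewrite mulrBl mul1r [X in X - _](reindex_inj inj) mulr_sumr -sumrB big1 // => x _.
  by rewrite exprMn subrr.
by move/eqP; rewrite mulf_eq0 subr_eq0 eq_sym (negPf gi) => /eqP.
Qed.

Lemma expf_pred (x : F) : x ^+ q.-1 = (x != 0)%:R.
Proof.
have q1 := finNzRing_gt1 F.
case: eqP => [->|/eqP xn0] /=; first by rewrite expr0n; case: q q1 => [|[]].
apply: (mulfI xn0); rewrite -exprS prednK ?expf_card ?mulr1 //; exact: ltnW.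
Qed.

End SchwartzZippel.

(** * Functions of hyperplane-code type and their affine parts *)

Section HyperplaneCodeFunctions.
Variable F : finFieldType.
Local Notation q := #|F|.

(** For a codeword, [s] is the sum of the coefficients of the hyperplanes. It is also the value at
    0, hence unchanged by linear substitutions. *)
Definition code_fun N (s : F) (C : 'rV[F]_N -> F) : Prop :=
  exists r : seq (F * 'cV[F]_N),
    forall v, C v = s - \sum_(p <- r) p.1 * (v *m p.2) 0 0 ^+ q.-1.

Lemma cardF_gt1 : (1 < q)%N. Proof. exact: finNzRing_gt1. Qed.

Lemma cardF_pred : q.-1 = q.-2.+1.
Proof. by have := cardF_gt1; case: q => [|[]]. Qed.

Lemma code_fun_mul N N' s (C : 'rV[F]_N -> F) (K : 'M_(N', N)) :
  code_fun s C -> code_fun s (fun v => C (v *m K)).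
Proof.
case=> r E; exists [seq (p.1, K *m p.2) | p <- r] => v.
by rewrite E big_map; congr (_ - _); apply: eq_bigr => p _; rewrite mulmxA.
Qed.

Lemma code_fun_at0 N s (C : 'rV[F]_N -> F) : code_fun s C -> C 0 = s.
Proof.
case=> r ->; rewrite big1 ?subr0 // => p _.
by rewrite mul0mx mxE expf_pred eqxx mulr0.
Qed.

Lemma code_funZ N s (C : 'rV[F]_N -> F) a v :
  code_fun s C -> a != 0 -> C (a *: v) = C v.
Proof.
move=> [r E] an0; rewrite !E; congr (_ - _); apply: eq_bigr => p _.
by rewrite -scalemxAl mxE exprMn (expf_pred a) an0 mul1r.
Qed.

(** Each power of a linear form has the same leading form on the affine chart as its restriction to
    infinity, so subtracting the values at infinity lowers the degree from q - 1 to q - 2. *)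
Lemma code_fun_affine m s (C : 'rV[F]_(1 + m) -> F) : code_fun s C ->
  polyfn q.-2 (fun y => C (row_cons 1 y) - C (row_cons 0 y)).
Proof.
case=> r E; have q1 := cardF_pred.
have H (p : F * 'cV[F]_(1 + m)) : true -> polyfn q.-2 (fun y : 'rV_m => (- p.1) *
    ((usubmx p.2 0 0 + (y *m dsubmx p.2) 0 0) ^+ q.-2.+1
      - (y *m dsubmx p.2) 0 0 ^+ q.-2.+1)).
  by move=> _; apply/polyfnZ/polyfn_affineX_diff.
have := polyfn_sum r H; apply: polyfn_ext => y.
rewrite !E opprB [RHS]addrC addrA subrK -sumrB; apply: eq_bigr => p _.
by rewrite !mul_row_scalar mul1r mul0r add0r q1 mulNr mulrBr opprB.
Qed.

(** Powers of x up to q - 2 sum to 0 over F, so only the values at infinity contribute. *)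
Lemma sum_column m s (C : 'rV[F]_(1 + (1 + m)) -> F) (z : 'rV_m) :
  code_fun s C ->
  (forall (x : F) z, C (row_cons 0 (row_cons x z)) = s * (x == 0)%:R) ->
  \sum_x C (row_cons 1 (row_cons x z)) = s.
Proof.
move=> hC C0; have [g Hg E] := code_fun_affine hC.
under eq_bigr => x _ do rewrite -[C _](subrK (C (row_mx 0%:M (row_mx x%:M z)))) E C0.
rewrite big_split exchange_big /= big1 ?add0r => [|i _]; last first.
  rewrite -mulr_suml sum_expf_lt ?mul0r //; apply: leq_trans (ltn_ord i) _.
  by rewrite [leqRHS]cardF_pred.
by rewrite -mulr_sumr (bigD1 0) //= eqxx big1 ?addr0 ?mulr1 // => x /negPf ->.
Qed.

(** With q' = k + 2 + j the claim rests on (j + 2)(k + 2) - 2 (k + 2 + j) = j k >= 0; strictness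
    comes from w. *)
Lemma slice_count_lt Q w q' k :
  (w < 2 * Q)%N -> (k < q'.-1)%N -> (q' * w < (q' - k) * ((q' - (q'.-2 - k)) * Q))%N.
Proof.
move=> wQ kq; have [j ->] : exists j, q' = (k + 2 + j)%N by exists (q' - (k + 2))%N; lia.
have -> : (k + 2 + j - k = j + 2)%N by lia.
have -> : (k + 2 + j - ((k + 2 + j).-2 - k) = k + 2)%N by lia.
apply: (@leq_trans ((k + 2 + j) * (2 * Q))%N); first by rewrite ltn_pmul2l //; lia.
rewrite !mulnA leq_mul2r; apply/orP; right; nia.
Qed.

Lemma affine_part_nonzero_sum m s (C : 'rV[F]_(1 + (1 + m)) -> F) :
  code_fun s C -> s != 0 ->
  (forall (x : F) z, C (row_cons 0 (row_cons x z)) = s * (x == 0)%:R) ->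
  (\sum_x #|[set z | C (row_cons 1 (row_cons x z)) != 0%R]|
    < 2 * q ^ m)%N ->
  exists t : F, forall x z,
    C (row_cons 1 (row_cons x z)) = s * (x == t)%:R.
Proof.
move=> hC sn0 C0 wt.
pose f x z := C (row_cons 1 (row_cons x z)).
have colf z : \sum_x f x z = s by apply: sum_column.
have [g Hg E] := code_fun_affine hC.
have q1 := cardF_pred.
have q10 : (0%N == q.-1) = false by rewrite q1.
(* The values at infinity are s - s x^(q-1); they add [s] to the constant coefficient and create a
   term of degree q - 1. *)
pose g' i := if i == q.-1 then fun _ => - s else
  if i == 0%N then fun z => s + g 0 z else g i.
have fn0 : exists x z, f x z != 0.
  case: (pickP (fun x : F => f x 0 != 0)) => [x fx|h]; first by exists x, 0.
  by case/eqP: sn0; rewrite -(colf 0) big1 // => x _; apply/eqP/negbFE/h.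
(* At [i = q.-1] the bound truncates to 0, which the constant [- s] meets. *)
have Hg' i : polyfn (q.-2 - i) (g' i).
  rewrite /g'; case: ifP => _; first exact: polyfn_const.
  case: eqP => [->|_]; last exact: Hg.
  by apply: polyfnD; [apply: polyfn_const | apply: Hg].
have E' x z : f x z = \sum_(i < q.-1.+1) x ^+ i * g' i z.
  rewrite /f -[LHS](subrK (C (row_mx 0%:M (row_mx x%:M z)))) E C0.
  rewrite [RHS]big_ord_recr /= {2}/g' eqxx expf_pred.
  have -> : \sum_(i < q.-1) x ^+ i * g' i z = s + \sum_(i < q.-2.+1) x ^+ i * g i z.
    transitivity (\sum_(i < q.-2.+1) x ^+ i * g' i z); first by rewrite -q1.
    rewrite !big_ord_recl /= addrA; congr (_ + _).
      by rewrite /g' q10 /= !mul1r.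
    apply: eq_bigr => i _; rewrite /bump !add1n /g'.
    have lt : (i.+1 < q.-1)%N by rewrite [ltnRHS]q1 ltnS ltn_ord.
    by rewrite (ltn_eqF lt).
  rewrite (_ : (x == 0)%:R = 1 - (x != 0)%:R); first by ring.
  by case: eqP; rewrite ?subr0 ?subrr.
have [kle Hs cnt] := polyfn_slices_card Hg' E' fn0.
set k := #|_| in kle Hs cnt.
have kq : k = q.-1.
  apply/eqP; rewrite eqn_leq kle leqNgt; apply/negP => klt.
  have qm : (0 < q ^ m)%N by rewrite expn_gt0 (ltnW cardF_gt1).
  by have := slice_count_lt wt klt; rewrite ltnNge cnt.
have Hs0 x : x \notin zero_slices f -> polyfn 0 (f x).
  by move/Hs; rewrite kq; have -> : (q.-2 - q.-1 = 0)%N by lia.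
have /cards1P[t Zt] : #|~: zero_slices f| == 1%N.
  by rewrite cardsCs setCK -/k kq -subn1 subKn ?(ltnW cardF_gt1).
exists t => x z; rewrite -/(f x z).
have fx u : u != t -> f u z = 0.
  move=> ut; have : u \in zero_slices f.
    by apply: contraNT ut; rewrite -in_setC Zt inE.
  by rewrite inE => /forallP/(_ z)/eqP.
case: eqP => [->|/eqP /fx -> //]; rewrite ?mulr0 ?mulr1 //.
(* A single slice is left, so its value at [z] is the whole column sum [s]. *)
by rewrite -(colf z) (bigD1 t) //= big1 ?addr0 // => u /fx.
Qed.

(** As in [slice_count_lt], but now j k > 0 provides the strictness. *)
Lemma slice_count_le Q w q' k : (0 < Q)%N ->
  (w <= 2 * Q)%N -> (0 < k < q'.-2)%N -> (q' * w < (q' - k) * ((q' - (q'.-2 - k)) * Q))%N.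
Proof.
move=> Q0 wQ kq; have [j [j0 ->]] : exists j, (0 < j)%N /\ q' = (k + 2 + j)%N.
  by exists (q' - (k + 2))%N; lia.
have -> : (k + 2 + j - k = j + 2)%N by lia.
have -> : (k + 2 + j - ((k + 2 + j).-2 - k) = k + 2)%N by lia.
apply: (@leq_ltn_trans ((k + 2 + j) * (2 * Q))%N); first by rewrite leq_mul2l wQ orbT.
by rewrite !mulnA ltn_mul2r Q0; nia.
Qed.

(** The zero slice [t0] gives k >= 1, and the count then forces k = q - 2. The two remaining slices
    have degree q - 2 - k = 0, and vanishing column sums make their constants opposite. *)
Lemma affine_part_zero_sum m (C : 'rV[F]_(1 + (1 + m)) -> F) (t0 : F)
    (w := (\sum_(x : F) #|[set z | C (row_cons 1 (row_cons x z)) != 0%R]|)%N) :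
  code_fun 0 C ->
  (forall y, C (row_cons 0 y) = 0) ->
  (forall z, C (row_cons 1 (row_cons t0 z)) = 0) ->
  (exists x z, C (row_cons 1 (row_cons x z)) != 0) ->
  (w <= 2 * q ^ m)%N ->
  w = (2 * q ^ m)%N /\
  exists v t1 t2 : F, [/\ v != 0, t1 != t2 & forall x z,
    C (row_cons 1 (row_cons x z)) = v * ((x == t1)%:R - (x == t2)%:R)].
Proof.
move=> hC C0 ft0 fn0 wt.
pose f x z := C (row_cons 1 (row_cons x z)).
have colf z : \sum_x f x z = 0 by apply: sum_column => // x z'; rewrite C0 mul0r.
have [g Hg E] := code_fun_affine hC.
have E' x z : f x z = \sum_(i < q.-2.+1) x ^+ i * g i z by rewrite -E C0 subr0.
have [kle Hs cnt] := polyfn_slices_card Hg E' fn0.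
have k0 : (0 < #|zero_slices f|)%N.
  by apply/card_gt0P; exists t0; rewrite inE; apply/forallP => z; apply/eqP/ft0.
set k := #|_| in kle Hs cnt k0.
have kq : k = q.-2.
  apply/eqP; rewrite eqn_leq kle leqNgt; apply/negP => klt.
  have qm : (0 < q ^ m)%N by rewrite expn_gt0 (ltnW cardF_gt1).
  have klt' : (0 < k < q.-2)%N by rewrite k0.
  by have := slice_count_le qm wt klt'; rewrite ltnNge cnt.
have q2 : (q - q.-2 = 2)%N by rewrite -subn2 subKn ?cardF_gt1.
split.
  apply/eqP; rewrite eqn_leq wt -(leq_pmul2l (ltnW cardF_gt1)).
  by apply: leq_trans cnt; rewrite kq q2 subnn subn0 mulnCA.
have Hs0 x : x \notin zero_slices f -> polyfn 0 (f x).
  by move/Hs; rewrite kq subnn.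
have /cards2P[t1 [t2 [t12 Zt]]] : #|~: zero_slices f| == 2%N.
  by rewrite cardsCs setCK -/k kq q2.
have fx u z : u != t1 -> u != t2 -> f u z = 0.
  move=> u1 u2; have : u \in zero_slices f.
    by apply: contraNT u1; rewrite -in_setC Zt !inE (negPf u2) orbF.
  by rewrite inE => /forallP/(_ z)/eqP.
have t1Z : t1 \notin zero_slices f by rewrite -in_setC Zt !inE eqxx.
have f1 z : f t1 z = f t1 0 by apply: polyfn0_const (Hs0 _ t1Z).
have f2 z : f t2 z = - f t1 0.
  have := colf z; rewrite (bigD1 t1) //= (bigD1 t2) 1?eq_sym //= big1 => [|u /andP[]].
    by rewrite addr0 f1 addrC => /eqP; rewrite addr_eq0 => /eqP.
  exact: fx.
exists (f t1 0), t1, t2; split=> // [|x z].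
  move: t1Z; rewrite inE negb_forall => /existsP[z]; by rewrite f1.
rewrite -/(f x z); case: eqP => [->|/eqP x1].
  by rewrite (negPf t12) subr0 mulr1.
case: eqP => [->|/eqP x2]; first by rewrite f2 mulr0n sub0r mulrN1.
by rewrite fx // subrr mulr0.
Qed.

End HyperplaneCodeFunctions.

(** * Averaging over the hyperplanes through a point *)

Section Averaging.
Variable F : finFieldType.
Local Notation q := #|F|.

(** A right inverse of [A] shows that u -> A u is onto, each fibre being a translate of the
    kernel. *)
Lemma row_free_card_ker k m (A : 'M[F]_(k, m)) : row_free A ->
  (#|[set u : 'cV_m | A *m u == 0%R]| * q ^ k = q ^ m)%N.
Proof.
move=> /row_freeP[B AB].
have -> : (q ^ m = #|{: 'cV[F]_m}|)%N by rewrite card_mx muln1.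
have -> : (q ^ k = #|{: 'cV[F]_k}|)%N by rewrite card_mx muln1.
rewrite mulnC -sum_nat_const -[RHS]sum1_card.
rewrite [RHS](partition_big (fun u => A *m u) xpredT) //=.
apply: eq_bigr => w _; rewrite -[LHS]sum1_card.
rewrite [RHS](reindex_inj (addIr (B *m w))).
by apply: eq_bigl => u; rewrite inE mulmxDr mulmxA AB mul1mx -[RHS]subr_eq0 addrK.
Qed.

(** Average over the q^(n+1) - 1 nonzero [u] with [v *m u = 0]. Each x in [S] is independent of [v],
    so q^n - 1 of them kill it, and q (q^n - 1) < q^(n+1) - 1. *)
Lemma light_hyperplane n (S : {set 'rV[F]_n.+2}) (v : 'rV_n.+2) :
  v != 0 -> {in S, forall x, row_free (col_mx v x)} ->
  (#|S| <= 2 * q ^ n * q.-1)%N ->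
  exists u : 'cV_n.+2, [/\ u != 0, v *m u = 0
    & (q * #|[set x in S | x *m u == 0%R]| < 2 * q ^ n * q.-1)%N].
Proof.
move=> v0 Sv leS; set T := (2 * q ^ n * q.-1)%N in leS *.
have q1 := cardF_gt1 F; have q0 := ltnW q1.
pose U := [set u : 'cV[F]_n.+2 | v *m u == 0] :\ 0.
have cU : (#|U| + 1 = q ^ n.+1)%N.
  have /row_free_card_ker : row_free v by rewrite /row_free rank_rV v0.
  rewrite (cardsD1 0) inE mulmx0 eqxx -/U addnC => cU.
  by apply/eqP; rewrite -(eqn_pmul2r q0) -expnSr -cU expn1.
have cUx x : x \in S -> (#|[set u in U | x *m u == 0%R]| + 1 = q ^ n)%N.
  move=> /Sv/row_free_card_ker; rewrite (cardsD1 0) inE mulmx0 eqxx addnC => cUx.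
  have q2 : (0 < q ^ 2)%N by rewrite expn_gt0 q0.
  apply/eqP; rewrite -(eqn_pmul2r q2) -expnD addn2 -cUx; apply/eqP.
  congr ((_ + _) * _)%N; apply: eq_card => u; rewrite !inE mul_col_mx.
  by rewrite col_mx_eq0; case: (u == 0); rewrite //= andbC.
case: (boolP [exists u in U, (q * #|[set x in S | x *m u == 0%R]| < T)%N]).
  by case/exists_inP => u; rewrite !inE => /andP[un0 /eqP vu] lt; exists u.
rewrite negb_exists_in => /forall_inP H; exfalso.
have dc : (\sum_(u in U) #|[set x in S | x *m u == 0%R]|
           = \sum_(x in S) #|[set u in U | x *m u == 0%R]|)%N.
  under eq_bigr do rewrite -sum1_card; under [RHS]eq_bigr do rewrite -sum1_card.
  rewrite (exchange_big_dep (mem S)) /=; last by move=> u x _; rewrite inE => /andP[].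
  by apply: eq_bigr => x xS; apply: eq_bigl => u; rewrite !inE xS.
have : (#|U| * T <= q * (#|S| * (q ^ n - 1)))%N.
  rewrite -sum_nat_const.
  apply: (@leq_trans (\sum_(u in U) q * #|[set x in S | x *m u == 0%R]|)).
    by apply: leq_sum => u uU; rewrite leqNgt H.
  rewrite -big_distrr dc leq_mul2l -sum_nat_const; apply/orP; right.
  by apply: leq_sum => x /cUx <-; rewrite addnK.
have T0 : (0 < T)%N by rewrite !muln_gt0 expn_gt0 q0 cardF_pred.
have Q0 : (0 < q ^ n)%N by rewrite expn_gt0 q0.
apply/negP; rewrite -ltnNge.
apply: (@leq_ltn_trans (q * (q ^ n - 1) * T)%N).
  by rewrite -mulnA leq_mul2l mulnC leq_mul2l leS !orbT.
rewrite ltn_mul2r T0 /=; move: cU q1 Q0; rewrite expnS.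
by move: (q ^ n)%N #|U| #|F| => Q u q'; clear; nia.
Qed.

Lemma col_to_unit m (a : 'cV[F]_(1 + m)) : a != 0 ->
  exists2 M : 'M[F]_(1 + m), M \in unitmx & M *m a = col_mx (1%:M : 'M_1) 0.
Proof.
move=> an0; have r1 : \rank a = 1%N by rewrite -mxrank_tr rank_rV trmx_eq0 an0.
(* Since [a] has rank one, the rank factorization reads a = c L e_1 with L invertible and c a
   scalar. *)
have := mulmx_ebase a; rewrite r1 => E.
set c := row_ebase a 0 0; set L := col_ebase a in E.
rewrite [row_ebase a]mx11_scalar -/c mul_mx_scalar (pid_mx_col _ m 1) in E.
have cn0 : c != 0 by apply: contraNneq an0 => c0; rewrite -E c0 scale0r.
have Lu : L \in unitmx by apply: col_ebase_unit.
exists (c^-1 *: invmx L); first by rewrite unitmxZ ?unitfE ?invr_eq0 // unitmx_inv.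
rewrite -E -scalemxAl -scalemxAr scalerA mulVf // scale1r.
by rewrite mulmxA mulVmx // mul1mx.
Qed.

End Averaging.

(** * Supports, restriction to a hyperplane, and cones *)

Section LightCodeFunctions.
Variable F : finFieldType.
Local Notation q := #|F|.

Lemma scalar11_eq0 (x : F) : ((x%:M : 'M_1) == 0) = (x == 0).
Proof.
apply/eqP/eqP => [/matrixP/(_ 0 0)|->]; last exact: raddf0.
by rewrite !mxE eqxx.
Qed.

(** The origin is left out: the value there is [s] and belongs to no projective point. *)
Definition code_supp N (C : 'rV[F]_N -> F) : {set 'rV[F]_N} :=
  [set v | (v != 0) && (C v != 0)].

Lemma code_supp_mul N (C : 'rV[F]_N -> F) (M : 'M_N) : M \in unitmx ->
  #|code_supp (fun v => C (v *m M))| = #|code_supp C|.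
Proof.
move=> Mu; have inj : injective (mulmx^~ M : 'rV[F]_N -> 'rV_N).
  exact: can_inj (mulmxK Mu).
rewrite -(card_imset _ inj); apply: eq_card => v; rewrite [RHS]inE.
apply/imsetP/idP => [[w]|/andP[v0 Cv]].
  rewrite inE => /andP[w0 Cw] ->; rewrite Cw andbT.
  by apply: contraNneq w0 => /(canRL (mulmxK Mu)) ->; rewrite mul0mx.
exists (v *m invmx M); last by rewrite mulmxKV.
rewrite inE mulmxKV // Cv andbT.
by apply: contraNneq v0 => /(canRL (mulmxKV Mu)) ->; rewrite mul0mx.
Qed.

(** Invariance under nonzero scalars gives all slices with nonzero first coordinate the size of the
    slice at 1. *)
Lemma code_supp_slices m s (C : 'rV[F]_(1 + (1 + m)) -> F) : code_fun s C ->
  #|code_supp C|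
  = (#|code_supp (fun y => C (row_cons 0 y))|
     + q.-1 * \sum_x #|[set z | C (row_cons 1 (row_cons x z)) != 0%R]|)%N.
Proof.
move=> hC; rewrite (card_rV_slices (fun v => (v != 0) && (C v != 0))) (bigD1 0) //=.
congr addn.
  by apply: eq_card => y; rewrite !inE row_mx_eq0 raddf0 eqxx.
rewrite -(card_rV_slices (fun y => C (row_cons 1 y) != 0)).
have -> : q.-1 = #|[pred x : F | x != 0]|.
  by rewrite -(cardsC1 (0 : F)); apply: eq_card => x; rewrite !inE.
rewrite -sum_nat_const; apply: eq_bigr => x xn0.
rewrite -[RHS](card_imset _ (scalerI xn0)); apply: eq_card => y; rewrite !inE.
apply/andP/imsetP => [[_ Cy]|[w]].
  exists (x^-1 *: y); last by rewrite scalerA divff // scale1r.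
  rewrite inE; apply: contraNneq Cy => E.
  by rewrite -(code_funZ _ hC (invr_neq0 xn0)) scale_row_mx scale_scalar_mx mulVf // E.
rewrite inE => Cw ->; split.
  by rewrite row_mx_eq0 negb_and scalar11_eq0 xn0.
apply: contraNneq Cw => E.
by rewrite -(code_funZ _ hC xn0) scale_row_mx scale_scalar_mx mulr1 E.
Qed.

(** Supplies the independence required by [light_hyperplane]: a dependent [x] would be a nonzero
    multiple of [v], where [C] vanishes too. *)
Lemma code_supp_free N s (C : 'rV[F]_N -> F) v : code_fun s C ->
  v != 0 -> C v = 0 -> {in code_supp C, forall x, row_free (col_mx v x)}.
Proof.
move=> hC v0 Cv x; rewrite inE => /andP[x0 Cx]; apply: inj_row_free => w.
rewrite -[w]hsubmxK [lsubmx w]mx11_scalar [rsubmx w]mx11_scalar.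
move: (lsubmx w 0 0) (rsubmx w 0 0) => a b.
rewrite mul_row_col !mul_scalar_mx => E.
have [b0|bn0] := eqVneq b 0.
  move/eqP: E; rewrite b0 scale0r addr0 scaler_eq0 (negPf v0) orbF => /eqP ->.
  by rewrite raddf0 row_mx0.
have Ex : x = (- (b^-1 * a)) *: v.
  apply: (scalerI bn0); rewrite scalerA mulrN mulrA divff // mul1r scaleNr.
  by apply/eqP; rewrite -addr_eq0 addrC E.
have c0 : - (b^-1 * a) != 0 by apply: contraNneq x0 => c0; rewrite Ex c0 scale0r.
by rewrite Ex (code_funZ _ hC c0) Cv eqxx in Cx.
Qed.

(* The factor q makes n = 0 meaningful, where the bound 2 q^(n-1) is below 1. *)
Definition light_classified n := forall s (C : 'rV[F]_n.+1 -> F), code_fun s C ->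
  (q * #|code_supp C| < 2 * q ^ n * q.-1)%N ->
  exists2 a : 'cV_n.+1, a != 0 & forall v, C v = s * (v *m a == 0)%:R.

(** There is only one projective point. If [C] were nonzero on it, the support would have q - 1
    vectors, and q (q - 1) >= 2 (q - 1). *)
Lemma light_classified0 : light_classified 0.
Proof.
move=> s C hC lt; exists 1%:M => [|v]; first exact: matrix_nonzero1.
rewrite mulmx1; have [->|v0] := eqVneq v 0; first by rewrite mulr1 (code_fun_at0 hC).
rewrite mulr0; apply/eqP; apply: contraTT lt => Cv; rewrite -leqNgt expn0 muln1.
have -> : #|code_supp C| = q.-1.
  have c1 : #|{: 'rV[F]_1}| = q by rewrite card_mx.
  rewrite -[in RHS]c1 -(cardsC1 0).
  apply: eq_card => w; rewrite !inE; have [//|w0] := eqVneq w 0.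
  have v00 : v 0 0 != 0 by apply: contraNneq v0 => E; rewrite [v]mx11_scalar E raddf0.
  have w00 : w 0 0 != 0 by apply: contraNneq w0 => E; rewrite [w]mx11_scalar E raddf0.
  have -> : w = (w 0 0 / v 0 0) *: v.
    by rewrite [v]mx11_scalar scale_scalar_mx mxE eqxx mulr1n divfK // -mx11_scalar.
  by rewrite (code_funZ _ hC) // mulf_neq0 // invr_eq0.
by rewrite leq_mul2r cardF_gt1 orbT.
Qed.

(** New coordinates turn the hyperplane [u] into the vanishing of the first coordinate; the support
    of the restriction then embeds into the part of the support of [C] on that hyperplane. *)
Lemma light_restriction n s (C : 'rV[F]_(1 + n.+1) -> F) (u : 'cV_(1 + n.+1)) :
  light_classified n -> code_fun s C -> u != 0 ->
  (q * #|[set x in code_supp C | x *m u == 0%R]| < 2 * q ^ n * q.-1)%N ->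
  exists M : 'M_(1 + n.+1), exists a : 'cV_n.+1,
    [/\ M \in unitmx, M *m u = col_mx (1%:M : 'M_1) 0, a != 0
      & forall y, C (row_cons 0 y *m M) = s * (y *m a == 0)%:R].
Proof.
move=> IH hC u0 lt; have [M Mu Mu1] := col_to_unit u0.
pose C' y := C (row_cons 0 y *m M).
have hC' : code_fun s C'.
  have [r E] := code_fun_mul (row_mx (0 : 'M_(_, 1)) 1%:M *m M) hC; exists r => y.
  by rewrite -E mulmxA mul_mx_row mulmx0 mulmx1 /C' raddf0.
have [|a a0 Ea] := IH s C' hC'; last by exists M, a.
apply: leq_ltn_trans lt; rewrite leq_mul2l; apply/orP; right.
have inj : injective (fun y : 'rV_n.+1 => row_mx (0%:M : 'M[F]_1) y *m M).
  by apply: inj_comp (can_inj (mulmxK Mu)) _ => y1 y2 /eq_row_mx[].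
rewrite -(card_imset _ inj); apply/subset_leq_card/subsetP => _ /imsetP[y yS ->].
move: yS; rewrite !inE => /andP[y0 ->]; rewrite andbT -mulmxA Mu1.
rewrite mul_row_col mulmx0 addr0 raddf0 mul0mx eqxx andbT.
apply: contraNneq y0 => /(canRL (mulmxK Mu)); rewrite mul0mx -row_mx0.
by case/eq_row_mx => _ ->.
Qed.

(** Scaling reduces a nonzero [x0] to 1. Independence of [z] makes [C] a cone over a function on a
    projective line. *)
Lemma code_fun_cone m s (C : 'rV[F]_(1 + (1 + m)) -> F) (f0 f : F -> F) :
  code_fun s C ->
  (forall x z, C (row_cons 0 (row_cons x z)) = f0 x) ->
  (forall x z, C (row_cons 1 (row_cons x z)) = f x) ->
  forall x0 x z, C (row_cons x0 (row_cons x z))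
    = if x0 == 0 then f0 x else f (x / x0).
Proof.
move=> hC E0 E1 x0 x z; case: eqP => [->|/eqP xn0]; first exact: E0.
rewrite -(E1 _ (x0^-1 *: z)) -[RHS](code_funZ _ hC xn0) !scale_row_mx !scale_scalar_mx.
by rewrite mulr1 scalerA divff // scale1r [x0 * _]mulrC divfK.
Qed.

(** The hyperplane that closes up the affine slice [x = t]. *)
Definition cone_col m (t : F) : 'cV[F]_(1 + (1 + m)) :=
  col_mx ((- t)%:M : 'M_1) (col_mx (1%:M : 'M_1) 0).

Lemma cone_colE m t x0 x (z : 'rV_m) :
  (row_cons x0 (row_cons x z) *m cone_col m t == 0)
  = (x == t * x0).
Proof.
rewrite /cone_col !mul_row_col mulmx0 addr0 mulmx1 mul_scalar_mx scale_scalar_mx -raddfD.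
by rewrite scalar11_eq0 /= mulrN addrC subr_eq0 [x0 * t]mulrC.
Qed.

Lemma cone_col_neq0 m t : cone_col m t != 0.
Proof. by rewrite /cone_col !col_mx_eq0 oner_eq0 andbF. Qed.

End LightCodeFunctions.

(** * Classification by induction on the dimension *)

Section Classification.
Variable F : finFieldType.
Local Notation q := #|F|.

Lemma lift_unit m (M : 'M[F]_m) : M \in unitmx ->
  block_mx (1%:M : 'M_1) 0 0 M \in unitmx.
Proof. by move=> Mu; rewrite unitmxE det_ublock unitrM det1 unitr1 -unitmxE. Qed.

Lemma classify_sum_neq0 n s (C : 'rV[F]_(1 + n.+1) -> F) (u : 'cV_(1 + n.+1)) :
  light_classified F n -> code_fun s C -> s != 0 -> u != 0 ->
  (#|code_supp C| < 2 * q ^ n * q.-1 + (0 < n))%N ->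
  (q * #|[set x in code_supp C | x *m u == 0%R]| < 2 * q ^ n * q.-1)%N ->
  exists2 a : 'cV_(1 + n.+1), a != 0 & forall v, C v = s * (v *m a == 0)%:R.
Proof.
move=> IH hC s0 u0 lt /(light_restriction IH hC u0)[M1 [a [M1u _ a0 Ea]]].
have [M2 M2u M2a] := @col_to_unit _ n a a0.
have Bu := lift_unit M2u; set B := block_mx _ _ _ _ in Bu.
have Mu : B *m M1 \in unitmx by rewrite unitmx_mul Bu.
pose C' v := C (v *m (B *m M1)).
have hC' : code_fun s C' := code_fun_mul _ hC.
have C'0 (x : F) (z : 'rV_n) :
    C' (row_cons 0 (row_cons x z)) = s * (x == 0)%:R.
  rewrite /C' mulmxA [row_mx _ _ *m B](@mul_row_block _ 1 1 n.+1 1 n.+1).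
  rewrite !mulmx0 mulmx1 addr0 raddf0 add0r -(raddf0 (@scalar_mx F 1)) Ea.
  by rewrite -mulmxA M2a (@mul_row_col _ 1 1 n 1) mulmx1 mulmx0 addr0 scalar11_eq0.
have [|t Et] := affine_part_nonzero_sum hC' s0 C'0.
  have q10 : (0 < q.-1)%N by rewrite cardF_pred.
  rewrite -(ltn_pmul2l q10) [ltnRHS]mulnC -(ltn_add2r (0 < n)).
  rewrite -(code_supp_mul C Mu) (code_supp_slices hC') in lt.
  (* For n > 0 the total may reach the bound, but (0, 0, 1, ..., 1) is a support vector at infinity,
     so the affine part stays strictly below. *)
  have S0 : ((0 < n) <= #|code_supp (fun y => C' (row_cons 0 y))|)%N.
    case: (posnP n) => // n0; apply/card_gt0P; exists (row_cons 0 (const_mx 1)).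
    rewrite inE C'0 eqxx mulr1 s0 andbT row_mx_eq0 negb_and.
    apply/orP; right.
    by apply/eqP => /matrixP/(_ 0 (Ordinal n0))/eqP; rewrite !mxE oner_eq0.
  by apply: leq_ltn_trans lt; rewrite addnC leq_add2r.
have C'E (v : 'rV_(1 + (1 + n))) : C' v = s * (v *m cone_col n t == 0)%:R.
  move: v; apply: rV_split => x0; apply: rV_split => x z.
  rewrite cone_colE (code_fun_cone hC' C'0 Et).
  case: eqP => [->|/eqP xn0]; first by rewrite mulr0.
  by rewrite -(inj_eq (mulIf xn0)) divfK.
exists (invmx (B *m M1) *m cone_col n t) => [|v].
  apply: contraNneq (cone_col_neq0 n t) => /(congr1 (mulmx (B *m M1))).
  by rewrite mulKVmx // mulmx0 => ->.
by rewrite mulmxA -C'E /C' mulmxKV.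
Qed.

Lemma classify_sum0 n (C : 'rV[F]_(1 + n.+1) -> F) (u : 'cV_(1 + n.+1)) :
  light_classified F n -> (2 < q)%N -> code_fun 0 C -> u != 0 ->
  (#|code_supp C| <= 2 * q ^ n * q.-1)%N ->
  (q * #|[set x in code_supp C | x *m u == 0%R]| < 2 * q ^ n * q.-1)%N ->
  (forall v, C v = 0) \/
  #|code_supp C| = (2 * q ^ n * q.-1)%N /\
  exists s : F, exists a b : 'cV_(1 + n.+1), [/\ s != 0, a != 0, b != 0
    & forall v, C v = s * ((v *m a == 0)%:R - (v *m b == 0)%:R)].
Proof.
move=> IH q2 hC u0 le lt.
have q1 : (0 < q.-1)%N by rewrite cardF_pred.
have [M1 [a [M1u _ _ Ea]]] := light_restriction IH hC u0 lt.
pose C1 v := C (v *m M1).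
have hC1 : code_fun 0 C1 := code_fun_mul _ hC.
have C10 y : C1 (row_cons 0 y) = 0 by rewrite /C1 Ea mul0r.
(* Otherwise the affine part alone gives q^(n+1) (q - 1) support vectors, too many as q > 2. *)
have [P C1P] : exists y, C1 (row_cons 1 y) = 0.
  case: (pickP (fun y : 'rV_n.+1 => C1 (row_cons 1 y) == 0)) => [y /eqP|h].
    by exists y.
  exfalso; move: le; rewrite -(code_supp_mul C M1u) (code_supp_slices hC1).
  rewrite -(card_rV_slices (fun y => C1 (row_cons 1 y) != 0)).
  rewrite (_ : [set y | _] = setT); last by apply/setP => y; rewrite !inE h.
  rewrite cardsT card_mx mul1n [(2 * _ * _)%N]mulnC leqNgt => /negP; apply.
  apply: (@leq_trans (q.-1 * q ^ (1 + n))%N); last exact: leq_addl.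
  by rewrite ltn_pmul2l // expnS ltn_pmul2r // expn_gt0 ltnW // cardF_gt1.
set v1 := row_cons 1 P in C1P.
have v1n0 : v1 != 0 by rewrite row_mx_eq0 scalar11_eq0 oner_eq0.
have le1 : (#|code_supp C1| <= 2 * q ^ n * q.-1)%N by rewrite code_supp_mul.
have [u2 [u2n0 v1u2 lt2]] := light_hyperplane v1n0 (code_supp_free hC1 v1n0 C1P) le1.
have [M3 [a3 [M3u M3u2 _ Ea3]]] := light_restriction IH hC1 u2n0 lt2.
(* As s = 0, the restriction to the second light hyperplane [u2] vanishes as well. *)
have C1u2 x : x *m u2 = 0 -> C1 x = 0.
  move=> xu2; rewrite -[x](mulmxKV M3u) -[x *m invmx M3]hsubmxK.
  suff -> : lsubmx (x *m invmx M3) = 0%:M :> 'M_1 by rewrite Ea3 mul0r.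
  have : x *m invmx M3 *m (M3 *m u2) = 0 by rewrite mulmxA mulmxKV.
  rewrite M3u2 -{1}[x *m invmx M3]hsubmxK mul_row_col mulmx1 mulmx0 addr0 => ->.
  by rewrite raddf0.
pose b := usubmx (u2 : 'cV_(1 + n.+1)); pose u' := dsubmx (u2 : 'cV_(1 + n.+1)).
have u2E : u2 = col_mx b u' by rewrite vsubmxK.
(* [u2] passes through [v1], which is off the first hyperplane, so the two hyperplanes differ. *)
have u'n0 : u' != 0.
  apply: contraNneq u2n0 => u'0; move: v1u2.
  rewrite u2E u'0 /v1 (@mul_row_col _ 1 1 n.+1 1).
  by rewrite mul1mx mulmx0 addr0 => ->; rewrite col_mx0.
(* Keeping the first coordinate, make [u'] the coordinate x; then [u2] cuts out the zero slice
   [x = - b] of the affine part. *)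
have [M2 M2u M2u'] := @col_to_unit _ n u' u'n0.
have Bu := lift_unit M2u; set B := block_mx _ _ _ _ in Bu.
pose C2 v := C1 (v *m B).
have hC2 : code_fun 0 C2 := code_fun_mul _ hC1.
have BE (x0 : F) (y : 'rV_n.+1) :
    row_cons x0 y *m B = row_cons x0 (y *m M2).
  by rewrite mul_row_block !mulmx0 mulmx1 addr0 add0r.
have C20 y : C2 (row_cons 0 y) = 0 by rewrite /C2 BE C10.
have C2t (z : 'rV_n) : C2 (row_cons 1 (row_cons (- b 0 0) z)) = 0.
  rewrite /C2 BE C1u2 // u2E (@mul_row_col _ 1 1 n.+1 1) mul1mx.
  rewrite -mulmxA M2u' (@mul_row_col _ 1 1 n 1) mulmx1.
  by rewrite mulmx0 addr0 [b]mx11_scalar -raddfD !mxE eqxx mulr1n subrr raddf0.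
have Mu : B *m M1 \in unitmx by rewrite unitmx_mul Bu.
have C2E v : C v = C2 (v *m invmx (B *m M1)).
  by rewrite /C2 /C1 -[_ *m B *m M1]mulmxA mulmxKV.
have suppE : #|code_supp C| = (q.-1 * \sum_(x : F) #|[set z : 'rV_n
    | C2 (row_cons 1 (row_cons x z)) != 0%R]|)%N.
  rewrite -(code_supp_mul C M1u) -(code_supp_mul C1 Bu) (code_supp_slices hC2).
  rewrite (_ : code_supp _ = set0) ?cards0 //; apply/setP => y.
  by rewrite !inE C20 eqxx andbF.
have wle : (\sum_(x : F) #|[set z : 'rV_n
    | C2 (row_cons 1 (row_cons x z)) != 0%R]| <= 2 * q ^ n)%N.
  by rewrite -(leq_pmul2l q1) -suppE [leqRHS]mulnC.
case: (pickP (fun p : F * 'rV[F]_n =>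
    C2 (row_cons 1 (row_cons p.1 p.2)) != 0)) => [[x z] /= nz|h].
  have [|w [s [t1 [t2 [s0 _ Es]]]]] := affine_part_zero_sum hC2 C20 C2t _ wle.
    by exists x, z.
  right; split; first by rewrite suppE w mulnC.
  have N0 t : invmx (B *m M1) *m cone_col n t != 0.
    apply: contraNneq (cone_col_neq0 n t) => /(congr1 (mulmx (B *m M1))).
    by rewrite mulKVmx // mulmx0 => ->.
  exists s, (invmx (B *m M1) *m cone_col n t1), (invmx (B *m M1) *m cone_col n t2).
  split=> // v; rewrite C2E !mulmxA; move: (v *m _); apply: rV_split => x0.
  apply: rV_split => x' z'; rewrite !cone_colE.
  rewrite (code_fun_cone hC2 (fun x z => C20 (row_mx x%:M z)) Es).
  case: eqP => [->|/eqP xn0]; first by rewrite !mulr0 subrr mulr0.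
  have dE t : (x' / x0 == t) = (x' == t * x0) by rewrite -(inj_eq (mulIf xn0)) divfK.
  by rewrite !dE.
left=> v; rewrite C2E; move: (v *m _); apply: rV_split => x0; apply: rV_split => x z.
rewrite (code_fun_cone hC2 (f := fun _ => 0) (fun x z => C20 (row_mx x%:M z))).
  by case: eqP.
by move=> x' z'; have /negbFE/eqP := h (x', z').
Qed.

(** Otherwise the support consists of all q^(n+2) - 1 nonzero vectors, more than 2 q^n (q - 1). *)
Lemma exists_zero n (C : 'rV[F]_n.+2 -> F) : (2 < q)%N ->
  (#|code_supp C| <= 2 * q ^ n * q.-1)%N -> exists2 v, v != 0 & C v = 0.
Proof.
move=> q2 le; case: (pickP (fun v : 'rV[F]_n.+2 => (v != 0) && (C v == 0))).
  by move=> v /andP[v0 /eqP Cv]; exists v.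
move=> h; exfalso; move: le; rewrite (_ : code_supp C = [set~ 0]).
  rewrite cardsC1 card_mx mul1n !expnS.
  have : (0 < q ^ n)%N by rewrite expn_gt0 ltnW // cardF_gt1.
  by move: q2; move: (q ^ n)%N #|F| => Q q'; clear; nia.
by apply/setP => v; rewrite !inE; have := h v; case: (v == 0) => //= ->.
Qed.

(* For n = 0 equality must be excluded: any two points of the projective line
   support a function with s <> 0. *)
Theorem light_code_fun n s (C : 'rV[F]_n.+2 -> F) :
  light_classified F n -> (2 < q)%N -> code_fun s C ->
  (#|code_supp C| < 2 * q ^ n * q.-1 + (0 < n))%N ->
  (#|code_supp C| <= 2 * q ^ n * q.-1)%N ->
  (exists2 a : 'cV_n.+2, a != 0 & forall v, C v = s * (v *m a == 0)%:R) \/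
  #|code_supp C| = (2 * q ^ n * q.-1)%N /\
  exists s : F, exists a b : 'cV_n.+2, [/\ s != 0, a != 0, b != 0
    & forall v, C v = s * ((v *m a == 0)%:R - (v *m b == 0)%:R)].
Proof.
move=> IH q2 hC lt le; have [v v0 Cv] := exists_zero q2 le.
have [u [u0 _ ltu]] := light_hyperplane v0 (code_supp_free hC v0 Cv) le.
have [s0|sn0] := eqVneq s 0; last by left; apply: classify_sum_neq0 ltu.
rewrite s0 in hC *; have [C0|H] := classify_sum0 IH q2 hC u0 le ltu; last by right.
by left; exists u => // w; rewrite C0 mul0r.
Qed.

Lemma light_classifiedP n : (2 < q)%N -> light_classified F n.
Proof.
move=> q2; elim: n => [|n IH]; first exact: light_classified0.
move=> s C hC lt.
have lt' : (#|code_supp C| < 2 * q ^ n * q.-1)%N.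
  by rewrite expnS mulnCA -mulnA ltn_pmul2l // ltnW ?cardF_gt1 in lt.
(* The strict inequality excludes the difference of two hyperplanes. *)
have [|//|[E _]] := light_code_fun IH q2 hC _ (ltnW lt'); last by rewrite E ltnn in lt'.
exact: leq_trans lt' (leq_addr _ _).
Qed.

End Classification.

(** * The prime field inside F *)

Section PrimeFieldEmbedding.
Variables (p : nat) (F : finFieldType).
Hypothesis charF : p \in [pchar F].

(** Codeword values are moved into F so that codewords become polynomial functions over F. *)
Definition Fp_embed (a : 'F_p) : F := (a : nat)%:R.

Let p_pr : prime p. Proof. exact: pcharf_prime charF. Qed.

Lemma Fp_embedD : {morph Fp_embed : a b / a + b}.
Proof.
move=> a b; rewrite /Fp_embed.
have -> : nat_of_ord (a + b) = ((nat_of_ord a + nat_of_ord b) %% p)%N.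
  by rewrite -[X in (_ %% X)%N](Fp_cast p_pr).
by rewrite (GRing.natr_mod_pchar charF) natrD.
Qed.

Lemma Fp_embed0 : Fp_embed 0 = 0. Proof. by []. Qed.

Lemma Fp_embed_inj : injective Fp_embed.
Proof.
move=> a b E; apply/eqP; rewrite -subr_eq0; apply/eqP/val_inj.
change (nat_of_ord (a - b) = 0%N).
have : Fp_embed (a - b) = 0.
  by apply: (addIr (Fp_embed b)); rewrite -Fp_embedD subrK add0r.
move/eqP; rewrite /Fp_embed -(GRing.dvdn_pcharf charF).
have : (nat_of_ord (a - b)%R < p)%N.
  by have := ltn_ord (a - b); rewrite [X in (_ < X)%N](Fp_cast p_pr).
by case: (nat_of_ord (a - b)) => // k lt /dvdn_leq => /(_ isT); rewrite leqNgt lt.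
Qed.

Lemma Fp_embedN : {morph Fp_embed : a / - a}.
Proof. by move=> a; apply/eqP; rewrite -addr_eq0 -Fp_embedD addNr. Qed.

Lemma Fp_embed_sum (I : Type) (r : seq I) (f : I -> 'F_p) :
  Fp_embed (\sum_(i <- r) f i) = \sum_(i <- r) Fp_embed (f i).
Proof. exact: (big_morph _ Fp_embedD Fp_embed0). Qed.

Lemma Fp_embedM_bool a (b : bool) : Fp_embed (a * b%:R) = Fp_embed a * b%:R.
Proof. by case: b; rewrite ?mulr1 ?mulr0. Qed.

End PrimeFieldEmbedding.

(** * Hyperplanes as kernels of column vectors *)

Section HyperplanesAsKernels.
Variables (F : finFieldType) (n : nat).
Local Notation q := #|F|.

Definition col_ker (a : 'cV[F]_n.+1) : {vspace 'rV[F]_n.+1} :=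
  lker (linfun (mulmxr a)).

Lemma mem_col_ker a v : (v \in col_ker a) = (v *m a == 0).
Proof. by rewrite memv_ker lfunE. Qed.

Lemma dim_col_ker a : a != 0 -> \dim (col_ker a) = n.
Proof.
move=> a0; pose f : 'Hom('rV[F]_n.+1, 'rV[F]_1) := linfun (mulmxr a).
have := limg_ker_dim f {:'rV[F]_n.+1}%VS.
rewrite capvC capvf -/(col_ker a) dimvf dim_matrix [X in _ = X]mul1n.
suff -> : \dim (limg f) = 1%N by rewrite addn1 => -[].
apply/eqP; rewrite eqn_leq; apply/andP; split.
  by apply: leq_trans (dimvS (subvf _)) _; rewrite dimvf dim_matrix.
rewrite lt0n dimv_eq0; apply: contraNneq a0 => im0; apply/eqP/matrixP => i j.
have : f (delta_mx 0 i) \in limg f by exact/memv_img/memvf.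
rewrite im0 memv0 lfunE /= -rowE => /eqP/matrixP/(_ 0 j).
by rewrite !mxE.
Qed.

(** A basis of [U] has fewer than n + 1 rows, so its cokernel has a nonzero column; this column
    kills [U], and the dimensions agree. *)
Lemma vspace_col_ker (U : {vspace 'rV[F]_n.+1}) : \dim U = n ->
  exists2 a, a != 0 & U = col_ker a.
Proof.
move=> dU; pose B := \matrix_(i < \dim U) (vbasis U)`_i.
have : cokermx B != 0.
  by rewrite -mxrank_eq0 mxrank_coker -lt0n subn_gt0 (leq_ltn_trans (rank_leq_row _)) ?dU.
case/matrix0Pn => i [j nz].
have c0 : col j (cokermx B) != 0.
  by apply: contraNneq nz => /colP/(_ i); rewrite !mxE => ->.
exists (col j (cokermx B)) => //; apply/eqP.
rewrite eqEdim dim_col_ker // [X in (_ <= X)%N]dU leqnn andbT.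
rewrite -[X in (X <= _)%VS](span_basis (vbasisP U)); apply/span_subvP => v /(nthP 0)[k].
rewrite size_tuple => lt <-; rewrite mem_col_ker.
have -> : (vbasis U)`_k = row (Ordinal lt) B by rewrite rowK.
by rewrite colE mulmxA -row_mul mulmx_coker raddf0 mul0mx.
Qed.

Lemma card_col_ker (a : 'cV[F]_n.+1) : a != 0 ->
  #|[set v : 'rV_n.+1 | v *m a == 0]| = (q ^ n)%N.
Proof.
move=> a0; have q0 := ltnW (cardF_gt1 F).
have /row_free_card_ker : row_free a^T by rewrite /row_free rank_rV trmx_eq0 a0.
rewrite expn1 expnSr => /eqP; rewrite eqn_pmul2r // => /eqP <-.
rewrite -(card_imset _ (@trmx_inj _ _ _)); apply: eq_card => u; rewrite [RHS]inE.
apply/imsetP/eqP => [[v]|E].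
  by rewrite inE => /eqP va ->; rewrite -trmx_mul va trmx0.
by exists u^T; rewrite ?trmxK // inE -[a]trmxK -trmx_mul E trmx0.
Qed.

Lemma point_vline (P : pg_point F n) : exists2 v, v != 0 & val P = <[v]>%VS.
Proof.
have dP : \dim (val P) = 1%N by apply/eqP/(valP P).
have v0 : vpick (val P) != 0 by rewrite vpick0 -dimv_eq0 dP.
exists (vpick (val P)) => //; apply/eqP.
by rewrite eq_sym eqEdim -memvE memv_pick dP dim_vline v0.
Qed.

End HyperplanesAsKernels.

(** * Codewords as functions on vectors, and the translation back *)

Section CodewordsAsFunctions.
Variables (p : nat) (F : finFieldType) (n : nat).
Hypothesis charF : p \in [pchar F].
Local Notation q := #|F|.

(** Only the zero vector spans no point; the default [s] there is left free to match the value at 0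
    of a [code_fun]. *)
Definition vec_fun (s : F) (c : pg_fun p F n) (v : 'rV[F]_n.+1) : F :=
  oapp (fun P : pg_point F n => Fp_embed F (c P)) s (insub <[v]>%VS).

Lemma vec_fun_point s c v (P : pg_point F n) :
  val P = <[v]>%VS -> vec_fun s c v = Fp_embed F (c P).
Proof. by move=> E; rewrite /vec_fun -E valK. Qed.

Lemma vec_fun0 s c : vec_fun s c 0 = s.
Proof. by rewrite /vec_fun insubN // dim_vline eqxx. Qed.

(** Group vectors by the point they span: each fibre consists of the q - 1 nonzero multiples of one
    generator. *)
Lemma card_vec_supp s c : #|code_supp (vec_fun s c)| = (q.-1 * pg_wt c)%N.
Proof.
pose pt (v : 'rV[F]_n.+1) : option (pg_point F n) := insub <[v]>%VS.
pose W := [set P | c P != 0].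
rewrite -sum1_card (partition_big pt (mem [set Some P | P in W])) /=; last first.
  move=> v; rewrite inE => /andP[v0]; rewrite /vec_fun /pt; case: insubP => [P _ _|].
    by rewrite /= => cP; apply: imset_f; rewrite inE; apply: contraNneq cP => ->.
  by rewrite dim_vline v0.
rewrite big_imset /=; last by move=> P Q _ _ [].
rewrite mulnC -sum_nat_const; apply: eq_bigr => P; rewrite inE => cP.
have [w w0 Pw] := point_vline P.
have -> : q.-1 = #|[set~ (0 : F)]| by rewrite cardsC1.
have inj : injective (fun x : F => x *: w).
  move=> x y /eqP; rewrite -subr_eq0 -scalerBl scaler_eq0 (negPf w0) orbF subr_eq0.
  by move/eqP.
rewrite -[RHS](card_imset _ inj) -[RHS]sum1_card; apply: eq_bigl => v; rewrite inE.
apply/andP/imsetP => [[/andP[v0 _]]|[x]].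
  rewrite /pt; case: insubP => // Q _ Qv /eqP[QP].
  have : v \in <[w]>%VS by rewrite -Pw -QP Qv memv_line.
  case/vlineP => x vx; exists x => //; rewrite !inE.
  by apply: contraNneq v0 => x0; rewrite vx x0 scale0r.
rewrite !inE => x0 ->; have xw0 : x *: w != 0 by rewrite scaler_eq0 negb_or x0.
have xwP : val P = <[x *: w]>%VS.
  apply/eqP; rewrite Pw eq_sym eqEdim !dim_vline w0 xw0 andbT -memvE.
  exact/memvZ/memv_line.
rewrite xw0 (vec_fun_point _ _ xwP) /pt -xwP valK; split=> //.
by apply: contraNneq cP => E; apply/eqP/(Fp_embed_inj charF).
Qed.

Lemma hyperplane_code_vec_fun c : (0 < n)%N -> c \in pg_hyperplane_code p F n ->
  exists s, code_fun s (vec_fun s c).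
Proof.
move=> n0 cC.
set X := [seq pg_chi p (pg_points H) | H : pg_hyperplane F n] in cC.
have cE := coord_span (cC : c \in <<in_tuple X>>%VS).
have aX (i : 'I_(size X)) : exists a : 'cV[F]_n.+1,
    forall (P : pg_point F n) v, val P = <[v]>%VS -> X`_i P = (v *m a == 0)%:R.
  have /mapP[H _ ->] := mem_nth 0 (ltn_ord i).
  have dH : \dim (val H) = n by rewrite (eqP (valP H)) prednK.
  have [a _ Ha] := vspace_col_ker dH; exists a => P v Pv.
  by rewrite ffunE inE Pv -memvE Ha mem_col_ker.
have [a Ea] := fin_all_exists aX.
pose al i := Fp_embed F (coord (in_tuple X) i c).
(* Each hyperplane contributes its coefficient times 1 - (v.a)^(q-1), so the constants add up to the
   sum of the coefficients. *)
exists (\sum_i al i), [seq (al i, a i) | i <- enum 'I_(size X)] => v.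
rewrite big_map big_enum /= -sumrB.
have [->|v0] := eqVneq v 0.
  rewrite vec_fun0; apply: eq_bigr => i _.
  by rewrite mul0mx mxE expf_pred eqxx mulr0 subr0.
have dv : \dim <[v]>%VS == 1%N by rewrite dim_vline v0.
rewrite (@vec_fun_point _ _ _ (Sub <[v]>%VS dv)) ?SubK // {1}cE sum_ffunE.
rewrite (Fp_embed_sum charF); apply: eq_bigr => i _; rewrite ffunE (Ea i _ v) ?SubK //.
transitivity (al i * (v *m a i == 0)%:R); first exact: Fp_embedM_bool.
rewrite expf_pred {1}[v *m a i]mx11_scalar scalar11_eq0.
by case: eqP; rewrite ?mulr1 ?mulr0 ?subr0 ?subrr.
Qed.

Lemma col_ker_hyperplane (a : 'cV[F]_n.+1) : (0 < n)%N -> a != 0 ->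
  exists H : pg_hyperplane F n, forall (P : pg_point F n) v,
    val P = <[v]>%VS -> pg_chi p (pg_points H) P = (v *m a == 0)%:R.
Proof.
move=> n0 a0; have dH : \dim (col_ker a) == n.-1.+1 by rewrite dim_col_ker ?prednK.
exists (Sub (col_ker a) dH) => P v Pv.
by rewrite ffunE inE Pv SubK -memvE mem_col_ker.
Qed.

End CodewordsAsFunctions.

Theorem theorem4p4 (p h q n : nat) (F : finFieldType)
  (hp : prime p) (hh : (0 < h)%N) (hq : q = (p ^ h)%N) (hF : #|F| = q)
  (hn : (1 < n)%N) (hq2 : (2 < q)%N)
  (c : pg_fun p F n) (hc : c \in pg_hyperplane_code p F n)
  (hwt : (0 < pg_wt c <= 2 * q ^ n.-1)%N) :
  (exists (alpha : 'F_p) (pi : pg_hyperplane F n),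
      pg_wt c = ((q ^ n - 1) %/ (q - 1))%N /\
      c = alpha *: pg_chi p (pg_points pi)) \/
  (exists (alpha : 'F_p) (pi rho : pg_hyperplane F n),
      pg_wt c = (2 * q ^ n.-1)%N /\
      c = alpha *: (pg_chi p (pg_points pi) - pg_chi p (pg_points rho))).
Proof.
have charF : p \in [pchar F] by apply: card_finPcharP hp; rewrite hF hq.
have n0 := ltnW hn.
have [s hC] := hyperplane_code_vec_fun charF n0 hc.
have wtE := card_vec_supp charF s c.
move: hwt hq2; rewrite -hF => /andP[wt0 wtle] q2.
have q0 : (0 < #|F|.-1)%N by rewrite cardF_pred.
have [P0 cP0] : exists P, c P != 0 by move/card_gt0P: wt0 => [P]; rewrite inE; exists P.
have [w w0 Pw] := point_vline P0.
have Cw := vec_fun_point s c Pw.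
have cwn0 : Fp_embed F (c P0) != 0.
  by apply: contraNneq cP0 => E; apply/eqP/(Fp_embed_inj charF).
have [m nE] : exists m, n = m.+2 by exists n.-2; case: (n) hn => [|[]].
subst n.
have le : (#|code_supp (vec_fun s c)| <= 2 * #|F| ^ m.+1 * #|F|.-1)%N.
  by rewrite wtE mulnC leq_mul2r wtle orbT.
(* Here n > 1 enters: the extra term is 1, so equality in the weight bound is allowed. *)
have lt : (#|code_supp (vec_fun s c)| < 2 * #|F| ^ m.+1 * #|F|.-1 + (0 < m.+1))%N.
  by rewrite addn1 ltnS.
have [[a a0 Ea]|[E [t [a [b [t0 a0 b0 Eab]]]]]] :=
  light_code_fun (@light_classifiedP F m.+1 q2) q2 hC lt le.
  have [wa sE] : w *m a = 0 /\ s = Fp_embed F (c P0).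
    move: cwn0; rewrite -Cw Ea; case: (boolP (w *m a == 0)) => [/eqP wa _|_].
      by rewrite mulr1.
    by rewrite mulr0 eqxx.
  left; exists (c P0); have [H hH] := col_ker_hyperplane p n0 a0; exists H; split.
    (* The support is the kernel of [a], which has q^n vectors, without the origin. *)
    have E : (#|F| ^ m.+2 - 1 = #|F|.-1 * pg_wt c)%N.
      rewrite -wtE -(card_col_ker a0) (cardsD1 0) inE mul0mx eqxx addKn.
      apply: eq_card => v; rewrite !inE Ea; case: (v *m a == 0); last first.
        by rewrite mulr0 eqxx !andbF.
      by rewrite mulr1 sE cwn0.
    by rewrite E subn1 mulKn.
  apply/ffunP => P; have [v _ Pv] := point_vline P; apply: (Fp_embed_inj charF).
  rewrite -(vec_fun_point s c Pv) Ea ffunE (hH P v Pv) sE.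
  by rewrite -Fp_embedM_bool.
have wtc : pg_wt c = (2 * #|F| ^ m.+1)%N.
  by apply/eqP; rewrite -(eqn_pmul2l q0) -wtE E mulnC.
have [A hA] := col_ker_hyperplane p n0 a0; have [B hB] := col_ker_hyperplane p n0 b0.
have cE (x : 'F_p) (g1 g2 : pg_fun p F m.+2) (a1 a2 : 'cV_m.+3) :
    (forall P v, val P = <[v]>%VS -> g1 P = (v *m a1 == 0)%:R) ->
    (forall P v, val P = <[v]>%VS -> g2 P = (v *m a2 == 0)%:R) ->
    (forall v, vec_fun s c v = Fp_embed F x * ((v *m a1 == 0)%:R - (v *m a2 == 0)%:R)) ->
    c = x *: (g1 - g2).
  move=> h1 h2 E12; apply/ffunP => P; have [v _ Pv] := point_vline P.
  apply: (Fp_embed_inj charF); rewrite -(vec_fun_point s c Pv) E12.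
  rewrite !ffunE (h1 P v Pv) (h2 P v Pv) mulrBr -!Fp_embedM_bool.
  by rewrite -(Fp_embedN charF) -(Fp_embedD charF) -mulrBr.
(* The scalar [t] is only known in F, so [alpha] is read off at a support point. That point lies on
   exactly one of the two hyperplanes; if it is the second, [alpha] embeds as [- t] and the
   hyperplanes are exchanged. *)
right; exists (c P0); move: cwn0; rewrite -Cw Eab.
case: (boolP (w *m a == 0)) => wa; case: (boolP (w *m b == 0)) => wb;
  rewrite ?subrr ?mulr0 ?eqxx //.
  exists A, B; split=> //; apply: cE hA hB _ => v.
  by rewrite -Cw !Eab wa (negPf wb) subr0 mulr1.
exists B, A; split=> //; apply: cE hB hA _ => v.
by rewrite -Cw !Eab (negPf wa) wb sub0r mulrN1 mulNr -mulrN opprB.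
Qed.
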